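(* Let $X=f^{-1}(0)\subseteq(\mathbb C^n,0)$ be a hypersurface. Suppose $C$ is an irreducible curve on $X$ with multiplicity $2$ at the origin, which is not a line, and suppose that the restriction $G|_{C-\{0\}}$ of the Gauss map of $X$ extends to an embedding on $C$. Then the fiber over $(0,0)$ of $\mathrm{Projan}(\mathcal R(J(f)_D|_{C\times C}))$ is the fiber over $(0,0)$ of $\mathrm{Projan}(\mathcal R(J(f)_{D-}|_{C\times C}))$.
   Context: $J(f)=JM(X)$ is the $\mathcal O_X$-module generated by $\partial f/\partial z_1,\dots,\partial f/\partial z_n$. With $\pi_1,\pi_2:X\times X\to X$ the projections and $h_D=(h\circ\pi_1,h\circ\pi_2)\in\mathcal O_{X\times X}^2$, $J(f)_D$ is generated by all $h_D$, $h\in J(f)$, and is generated by $(\partial f/\partial z_j)_D$, $1\le j\le n$, together with $(0,(z_i\circ\pi_1-z_i\circ\pi_2)\,\frac{\partial f}{\partial z_j}\circ\pi_2)$, $1\le i,j\le n$; $J(f)_{D-}$ is the submodule generated by the $(\partial f/\partial z_j)_D$. $(\cdot)|_{C\times C}$ is restriction to $C\times C$ with the restricted generators. For a module $\mathcal N\subseteq\mathcal O_Y^q$ with generators forming the columns of a $q\times m$ matrix $[\mathcal N]$, $\mathrm{Projan}(\mathcal R(\mathcal N))$ is the closure in $Y\times\mathbb P^{m-1}$ of the set of $(y,[\ell])$ with $[\mathcal N(y)]$ of maximal rank (equal to the generic rank of $\mathcal N$) and $\ell\ne0$ in the row space of $[\mathcal N(y)]$. Taking for $J(f)_D$ the $n+n^2$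 generators $(\partial f/\partial z_j)_D$, $1\le j\le n$, followed by $(0,(z_i\circ\pi_1-z_i\circ\pi_2)\,\frac{\partial f}{\partial z_j}\circ\pi_2)$, $1\le i,j\le n$, and for $J(f)_{D-}$ the $n$ generators $(\partial f/\partial z_j)_D$, $1\le j\le n$, the fiber for $J(f)_D$ lies in $\mathbb P^{n+n^2-1}$ and the fiber for $J(f)_{D-}$ lies in $\mathbb P^{n-1}$, regarded as the subspace of $\mathbb P^{n+n^2-1}$ where the last $n^2$ coordinates vanish. The Gauss map $G:X\setminus\mathrm{Sing}(X)\to\mathbb P^{n-1}$ is $G(x)=\langle Df(x)\rangle$; $C\setminus\{0\}$ lies in the smooth locus of $X$. With $\eta:(\mathbb C,0)\to(C,0)$ the normalization of $C$, the hypothesis that $G|_{C-\{0\}}$ extends to an embedding on $C$ means that $G\circ\eta$ extends holomorphically across $0$ to an immersion germ $(\mathbb C,0)\to\mathbb P^{n-1}$ (i.e. with nonzero derivative at $0$). *)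

(* Defs.v *)
From mathcomp Require Import all_boot all_order all_algebra generic_quotient.
From mathcomp Require Import all_classical all_reals all_analysis.

Set Implicit Arguments.
Unset Strict Implicit.
Unset Printing Implicit Defensive.

Import Order.TTheory GRing.Theory Num.Theory numFieldNormedType.Exports.

Local Open Scope classical_set_scope.
Local Open Scope quotient_scope.
Local Open Scope ring_scope.

(* The definitions are generic in K : numClosedFieldType, so that the topology
   of K is inferred; they are meant for K := R[i] with R : realType.
   Germs at a point are represented by global functions and sets whose values
   only matter near that point. *)

(* K-differentiable near p with continuous differential (Hoermander, An
   Introduction to Complex Analysis in Several Variables, Def. 2.1.1: C^1 and
   Cauchy-Riemann). *)
Definition holomorphic_at (K : numClosedFieldType) (V W : normedModType K)
    (f : V -> W) (p : V) : Prop :=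
  \forall q \near p,
    differentiable f q /\ forall v, {for q, continuous (fun x => 'd f x v)}.

Definition Df (K : numClosedFieldType) (n : nat) (f : 'rV[K]_n -> K)
    (z : 'rV[K]_n) : 'rV[K]_n :=
  \row_(j < n) 'D_(delta_mx 0 j) f z.

Definition punctured (K : numClosedFieldType) (m : nat) : topologicalType :=
  set_type [set v : 'rV[K]_m | v != 0].

Definition same_line (K : numClosedFieldType) (m : nat)
    (u v : punctured K m) : bool :=
  ((set_val u : 'rV[K]_m) == (set_val v : 'rV[K]_m))%MS.

Lemma same_line_refl (K : numClosedFieldType) (m : nat) :
  reflexive (@same_line K m).
Proof. by move=> u; rewrite /same_line !submx_refl. Qed.

Lemma same_line_sym (K : numClosedFieldType) (m : nat) :
  symmetric (@same_line K m).
Proof. by move=> u v; rewrite /same_line andbC. Qed.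

Lemma same_line_trans (K : numClosedFieldType) (m : nat) :
  transitive (@same_line K m).
Proof.
move=> v u w /andP[uv vu] /andP[vw wv]; apply/andP.
by split; [exact: submx_trans uv vw | exact: submx_trans wv vu].
Qed.

Canonical same_line_equiv (K : numClosedFieldType) (m : nat) :=
  EquivRel (@same_line K m) (@same_line_refl K m) (@same_line_sym K m)
    (@same_line_trans K m).

(* P^{m-1}, indexed by the number m of homogeneous coordinates. *)
Definition projective (K : numClosedFieldType) (m : nat) : topologicalType :=
  quotient_topology {eq_quot (same_line_equiv K m)}.

Definition line_of (K : numClosedFieldType) (m : nat) (v : 'rV[K]_m)
    (v_neq0 : v != 0) : projective K m :=
  (\pi_{eq_quot (same_line_equiv K m)}
    (SigSub (mem_set v_neq0 : v \in [set v : 'rV[K]_m | v != 0]))).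

Definition coords (K : numClosedFieldType) (m : nat) (p : projective K m) :
    'rV[K]_m :=
  set_val (repr (p : {eq_quot (same_line_equiv K m)})).

Lemma coords_neq0 (K : numClosedFieldType) (m : nat) (p : projective K m) :
  coords p != 0.
Proof. exact: (set_valP (repr (p : {eq_quot (same_line_equiv K m)}))). Qed.

Lemma row_mx0_neq0 (K : numClosedFieldType) (m k : nat) (v : 'rV[K]_m) :
  v != 0 -> row_mx v (0 : 'rV[K]_k) != 0.
Proof. by apply: contra_neq => h; rewrite -(row_mxKl v (0 : 'rV_k)) h linear0. Qed.

Definition proj_incl (K : numClosedFieldType) (m k : nat)
    (p : projective K m) : projective K (m + k) :=
  line_of (row_mx0_neq0 k (coords_neq0 p)).

Definition affine_chart (K : numClosedFieldType) (m : nat) (j : 'I_m)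
    (p : projective K m) : 'rV[K]_m :=
  (coords p 0 j)^-1 *: coords p.

(* The j-th affine coordinate of affine_chart is constantly 1, so the
   derivative below is that of the remaining m - 1 coordinates. *)
Definition immersion_germ (K : numClosedFieldType) (m : nat)
    (g : K -> projective K m) : Prop :=
  exists j : 'I_m,
    [/\ \forall t \near (0 : K), coords (g t) 0 j != 0,
        holomorphic_at (fun t : K => affine_chart j (g t)) 0
      & derive1 (fun t : K => affine_chart j (g t)) 0 != 0].

Definition subgerm (K : numClosedFieldType) (n : nat) (A B : set 'rV[K]_n) :=
  \forall z \near (0 : 'rV[K]_n), A z -> B z.

Definition analytic_germ (K : numClosedFieldType) (n : nat)
    (A : set 'rV[K]_n) : Prop :=
  exists (k : nat) (g : 'I_k -> 'rV[K]_n -> K),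
    (forall i, holomorphic_at (g i) 0) /\
    \forall z \near (0 : 'rV[K]_n), A z <-> forall i, g i z = 0.

Definition irreducible_germ (K : numClosedFieldType) (n : nat)
    (A : set 'rV[K]_n) : Prop :=
  [/\ A 0, analytic_germ A
    & forall A1 A2 : set 'rV[K]_n, analytic_germ A1 -> analytic_germ A2 ->
        subgerm A (A1 `|` A2) -> subgerm A A1 \/ subgerm A A2].

(* The dimension of an analytic germ is the least number of holomorphic
   functions vanishing at 0 whose common zeros isolate 0 in the germ. *)
Definition dim1_germ (K : numClosedFieldType) (n : nat)
    (A : set 'rV[K]_n) : Prop :=
  ~ subgerm A [set 0] /\
  exists g : 'rV[K]_n -> K,
    [/\ holomorphic_at g 0, g 0 = 0 & subgerm (A `&` [set z | g z = 0]) [set 0]].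

Definition irreducible_curve (K : numClosedFieldType) (n : nat)
    (C : set 'rV[K]_n) : Prop :=
  irreducible_germ C /\ dim1_germ C.

(* A generic hyperplane close to 0 but not through 0 meets C, near 0, in
   exactly m points. *)
Definition curve_multiplicity (K : numClosedFieldType) (n : nat)
    (C : set 'rV[K]_n) (m : nat) : Prop :=
  exists L : set 'cV[K]_n,
    [/\ open L, dense L
      & forall l, L l -> forall V, nbhs (0 : 'rV[K]_n) V ->
          exists U : set 'rV[K]_n, [/\ nbhs (0 : 'rV[K]_n) U, U `<=` V
            & \forall e \near (0 : K)^',
                (C `&` U `&` [set z | (z *m l) 0 0 = e]) #= `I_m]%card].

Definition line_germ (K : numClosedFieldType) (n : nat)
    (C : set 'rV[K]_n) : Prop :=
  exists v : 'rV[K]_n,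
    v != 0 /\ \forall z \near (0 : 'rV[K]_n), C z <-> (z <= v)%MS.

(* For an irreducible curve germ: a germ of homeomorphism (K, 0) -> (C, 0) that
   is holomorphic, and biholomorphic outside the origin. *)
Definition normalization (K : numClosedFieldType) (n : nat)
    (C : set 'rV[K]_n) (eta : K -> 'rV[K]_n) : Prop :=
  [/\ holomorphic_at eta 0 /\ eta 0 = 0,
      \forall t \near (0 : K), C (eta t),
      \forall s \near (0 : K) & t \near (0 : K), eta s = eta t -> s = t,
      forall U : set K, nbhs 0 U -> subgerm C (eta @` U)
    & \forall t \near (0 : K)^', derive1 eta t != 0].

Definition hypersurface (K : numClosedFieldType) (n : nat)
    (f : 'rV[K]_n -> K) : Prop :=
  [/\ holomorphic_at f 0, f 0 = 0
    & ~ \forall z \near (0 : 'rV[K]_n), f z = 0].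

Definition zeros (K : numClosedFieldType) (n : nat) (f : 'rV[K]_n -> K) :
    set 'rV[K]_n :=
  [set z | f z = 0].

Definition smooth_locus (K : numClosedFieldType) (n : nat)
    (f : 'rV[K]_n -> K) : set 'rV[K]_n :=
  [set z | f z = 0 /\ Df f z != 0].

Definition gauss_map (K : numClosedFieldType) (n : nat) (f : 'rV[K]_n -> K)
    (x : 'rV[K]_n) (x_smooth : smooth_locus f x) : projective K n :=
  line_of (proj2 x_smooth).

Definition gauss_extends_to_embedding (K : numClosedFieldType) (n : nat)
    (f : 'rV[K]_n -> K) (eta : K -> 'rV[K]_n) : Prop :=
  exists g : K -> projective K n,
    (\forall t \near (0 : K)^',
       exists x_smooth : smooth_locus f (eta t), g t = gauss_map x_smooth) /\
    immersion_germ g.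

(* [N y] has maximal rank on the germ (Y, y0): near y0 this says that its rank
   is the generic rank. *)
Definition maximal_rank (K : numClosedFieldType) (T : topologicalType)
    (q m : nat) (Y : set T) (N : T -> 'M[K]_(q, m)) (y0 y : T) : Prop :=
  \forall y' \near y0, Y y' -> (\rank (N y') <= \rank (N y))%N.

(* Only meaningful over a neighborhood of y0. *)
Definition projan (K : numClosedFieldType) (T : topologicalType) (q m : nat)
    (Y : set T) (N : T -> 'M[K]_(q, m)) (y0 : T) :
    set (T * projective K m) :=
  closure [set yl : T * projective K m |
    [/\ Y yl.1, maximal_rank Y N y0 yl.1 & (coords yl.2 <= N yl.1)%MS]]
  `&` [set yl | Y yl.1].

Definition projan_fiber (K : numClosedFieldType) (T : topologicalType)
    (q m : nat) (Y : set T) (N : T -> 'M[K]_(q, m)) (y0 : T) :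
    set (projective K m) :=
  [set l | projan Y N y0 (y0, l)].

(* Columns: (df/dz_j)_D. *)
Definition JDminus (K : numClosedFieldType) (n : nat) (f : 'rV[K]_n -> K)
    (xy : 'rV[K]_n * 'rV[K]_n) : 'M[K]_(1 + 1, n) :=
  col_mx (Df f xy.1) (Df f xy.2).

(* Columns: those of JDminus, then (0, (x_i - y_i) df/dz_j(y)) for all i, j. *)
Definition JD (K : numClosedFieldType) (n : nat) (f : 'rV[K]_n -> K)
    (xy : 'rV[K]_n * 'rV[K]_n) : 'M[K]_(1 + 1, n + n * n) :=
  row_mx (JDminus f xy)
    (col_mx 0 (mxvec (\matrix_(i < n, j < n)
                        ((xy.1 0 i - xy.2 0 i) * Df f xy.2 0 j)))).

Definition projan_fiber_CxC (K : numClosedFieldType) (n q m : nat)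
    (C : set 'rV[K]_n) (N : 'rV[K]_n * 'rV[K]_n -> 'M[K]_(q, m)) :
    set (projective K m) :=
  projan_fiber (C `*` C) N (0, 0).

(* Main.v *)
(* Write Df(eta t) = c(t) u(t), where u is the affine chart of the extended
   Gauss map, so that u'(0) <> 0.  For s <> t near 0 with c(s), c(t) <> 0, the
   row space of J(f)_D at (eta s, eta t) is spanned by (u(s), 0) and by the
   difference quotient
     ((u(s) - u(t)) / (s - t), - ((eta(s) - eta(t)) / (s - t)) tensor u(t)).
   Since C has multiplicity 2, eta'(0) = 0: otherwise a generic hyperplane
   close to 0 would meet C only once.  So, as s, t -> 0, the row space tends to
   the span of (u(0), 0) and (u'(0), 0), which is also the limit for J(f)_{D-};
   both fibers are the projective line of this plane. *)

Require Import Defs.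
From mathcomp Require Import all_boot all_order all_algebra complex.
From mathcomp Require Import generic_quotient.
From mathcomp Require Import all_classical all_reals all_analysis.
From mathcomp Require Import ring.

Set Implicit Arguments.
Unset Strict Implicit.
Unset Printing Implicit Defensive.

Import Order.TTheory GRing.Theory Num.Theory numFieldNormedType.Exports.

Local Open Scope classical_set_scope.
Local Open Scope complex_scope.
Local Open Scope quotient_scope.
Local Open Scope ring_scope.

(** * The mean value inequality over the complex numbers *)

(* Canonical topologies are not inferred on the bare type R[i]. *)
Definition Cfield (R : realType) : numClosedFieldType := R[i].

Lemma Re_continuous (R : realType) :
  continuous (fun z : Cfield R => complex.Re z).
Proof.
move=> z A [/= e e0 eA]; exists (e%:C : R[i]); first by rewrite /= ltcR.
move=> w /= zw; apply: eA => /=; rewrite -ltcR (le_lt_trans _ zw) //.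
by rewrite -raddfB normc_ge_Re.
Qed.

Lemma real_complex_dnbhs0 (R : realType) :
  (fun x : R => x%:C : Cfield R) @ 0^' --> (0 : Cfield R)^'.
Proof.
move=> A [/= e e0 eA]; have e_real : (complex.Re e)%:C = e.
  by apply/eqP; move: e0; rewrite ltcE /= => /andP[/eqP Im_e _];
    rewrite eq_complex /= -Im_e !eqxx.
exists (complex.Re e) => [|x /= xe x0].
  by rewrite /= -ltcR e_real.
apply: eA => /=; last by rewrite (inj_eq (@complexI R)).
rewrite -e_real sub0r normrN.
by move: xe; rewrite sub0r normrN -ltcR normc_def /= expr0n addr0 sqrtr_sqr.
Qed.

(** Letting the complex increment tend to 0 through real values and composing with the continuous
    real part turns the complex directional derivative into a real one, to which the real mean value
    theorem applies. *)
Lemma is_derive_Re_line (R : realType) (h : Cfield R -> Cfield R)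
    (c t d : Cfield R) (x : R) :
  differentiable h (t + x%:C * d) ->
  is_derive x 1 (fun y : R => complex.Re (c * h (t + y%:C * d)))
    (complex.Re (c * 'D_d h (t + x%:C * d))).
Proof.
move=> dh; have /(_ d) dv := diff_derivable dh.
have L : (fun k : R =>
    k^-1 *: (complex.Re (c * h (t + (k + x)%:C * d)) - complex.Re (c * h (t + x%:C * d))))
    @ 0^' --> complex.Re (c * 'D_d h (t + x%:C * d)).
  have : (fun k : Cfield R =>
      c * (k^-1 *: (h (k *: d + (t + x%:C * d)) - h (t + x%:C * d)))) @ 0^'
     --> c * 'D_d h (t + x%:C * d).
    apply: cvgM; [exact: cvg_cst | exact: dv].
  move=> L1; have L2 := cvg_comp _ _ (@real_complex_dnbhs0 R) L1.
  have := cvg_comp _ _ L2 (@Re_continuous R _).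
  apply: cvg_trans; apply: near_eq_cvg; near=> k => /=.
  rewrite rmorphD /= mulrDl.
  rewrite addrCA -raddfB -mulrBr -fmorphV /=; move: (h _ - h _) => w.
  rewrite [_ *: w]/(_ * w) mulrCA; move: (c * w) => [u v].
  by rewrite /= mul0r subr0.
have E : (fun k : R =>
    k^-1 *: (((fun y : R => complex.Re (c * h (t + y%:C * d))) \o shift x) (k *: 1)
   - complex.Re (c * h (t + x%:C * d)))) =
  (fun k : R => k^-1 *:
    (complex.Re (c * h (t + (k + x)%:C * d)) - complex.Re (c * h (t + x%:C * d)))).
  by apply/funext => k /=; rewrite [k *: 1]mulr1.
apply: DeriveDef.
  by rewrite /derivable E; apply/cvg_ex; eexists; exact: L.
by rewrite /derive E; apply: cvg_lim.
Unshelve. all: try by end_near. Qed.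

(** The mean value theorem fails for complex values, so it is applied to the real part of [w^* h]
    along the segment, where [w = h s - h t]. Its increment is [|w|^2] and its derivative is at most
    [|w| e]; one factor [|w|] cancels. *)
Lemma mean_value_complex (R : realType) (h : Cfield R -> Cfield R)
    (s t e : Cfield R) :
  (forall x : R, 0 <= x <= 1 -> differentiable h (t + x%:C * (s - t)) /\
     `|'D_(s - t) h (t + x%:C * (s - t))| <= e) ->
  `|h s - h t| <= e.
Proof.
move=> H; set w := h s - h t.
have [->|w0] := eqVneq w 0.
  by rewrite normr0; have [|_] := H 0; [rewrite lexx ler01 | apply: le_trans].
pose psi (y : R) := complex.Re (w^*%C * h (t + y%:C * (s - t))).
have dpsi (x : R) : 0 <= x <= 1 ->
    is_derive x 1 psi (complex.Re (w^*%C * 'D_(s - t) h (t + x%:C * (s - t)))).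
  by move=> /H[? _]; exact: is_derive_Re_line.
have [|x x01||x] := @MVT R psi
  (fun x : R => complex.Re (w^*%C * 'D_(s - t) h (t + x%:C * (s - t)))) 0 1.
- exact: ltr01.
- by apply: dpsi; move: x01; rewrite in_itv /= => /andP[/ltW -> /ltW ->].
- apply: derivable_within_continuous => x; rewrite in_itv /= => /dpsi[//].
rewrite in_itv /= => /andP[/ltW x0 /ltW x1]; rewrite subr0 mulr1.
have -> : psi 1 = complex.Re (w^*%C * h s).
  by rewrite /psi rmorph1 mul1r [t + _]addrC subrK.
have -> : psi 0 = complex.Re (w^*%C * h t).
  by rewrite /psi rmorph0 mul0r addr0.
rewrite -raddfB -mulrBr /= -/w => E.
have [|_ le_e] := H x; first by rewrite x0.
rewrite -(ler_pM2l (x := `|w|)) ?normr_gt0 //.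
have -> : `|w| * `|w| = (complex.Re (w^*%C * w))%:C.
  rewrite -expr2 sqr_normc mulrC; case: (w) => a b.
  by apply/eqP; rewrite eq_complex /= eqxx /= mulNr [b * a]mulrC addrN.
rewrite E (le_trans (y := `|w^*%C * 'D_(s - t) h (t + x%:C * (s - t))|)) //.
  by apply: le_trans (normc_ge_Re _); rewrite lecR ler_norm.
by rewrite normrM normcJ ler_wpM2l.
Qed.

(** * Topology of projective space *)

Section Projective.
Variables (K : numClosedFieldType) (m : nat).
Implicit Types (u v : 'rV[K]_m) (p : projective K m).

Lemma coords_line_of v (v0 : v != 0) : (coords (line_of v0) == v)%MS.
Proof.
rewrite /coords /line_of; set x := SigSub _.
have /eqmodP : (repr (\pi_{eq_quot (same_line_equiv K m)} x) = x
   %[mod {eq_quot (same_line_equiv K m)}])%qT by rewrite reprK.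
exact.
Qed.

Lemma projective_eqP p q : (coords p == coords q)%MS -> p = q.
Proof.
move=> pq; rewrite -[p](@reprK _ {eq_quot (same_line_equiv K m)}).
by rewrite -[q](@reprK _ {eq_quot (same_line_equiv K m)}); apply/eqmodP.
Qed.

Lemma eqmx_row_scale u v : u != 0 -> (u == v)%MS -> exists2 c, c != 0 & v = c *: u.
Proof.
move=> u0 /andP[uv /sub_rVP[c vE]]; exists c => //.
apply: contra_neq u0 => c0; apply/eqP.
by rewrite -submx0 (submx_trans uv) // vE c0 scale0r submx0.
Qed.

Lemma coords_pi (x : punctured K m) :
  exists2 c : K, c != 0 &
    coords (\pi_{eq_quot (same_line_equiv K m)} x : projective K m) =
      c *: set_val x.
Proof.
apply: (eqmx_row_scale (u := set_val x)); first exact: (set_valP x).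
have /eqmodP : (x = repr (\pi_{eq_quot (same_line_equiv K m)} x)
   %[mod {eq_quot (same_line_equiv K m)}])%qT by rewrite reprK.
exact.
Qed.

(** [coords] picks an arbitrary representative and need not be continuous, hence the free factor
    [c]. The union of all nonzero dilates of an open set is open and saturated, so it descends to
    the quotient. *)
Lemma nbhs_projective_cone p (W : set 'rV[K]_m) : nbhs (coords p) W ->
  nbhs p [set q | exists2 c : K, c != 0 & W (c *: coords q)].
Proof.
move=> Wp.
have [W' [oW' W'p] W'W] : exists2 B, open_nbhs (coords p) B & B `<=` W.
  by move: Wp; rewrite nbhsE.
rewrite nbhsE /=; exists [set q | exists2 c : K, c != 0 & W' (c *: coords q)].
  split; last by exists 1; rewrite ?oner_neq0 ?scale1r.
  rewrite /open /= /quotient_open.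
  exists [set v : 'rV[K]_m | exists2 c : K, c != 0 & W' (c *: v)].
    rewrite [X in open X](_ : _ = \bigcup_(c in [set c : K | c != 0])
        ( *:%R c) @^-1` W'); last by apply/seteqP; split => v [c] ? ?; exists c.
    apply: bigcup_open => c _; apply: open_comp => // v _.
    exact: scaler_continuous.
  apply/seteqP; split => x /= [c c0 W'c]; have [d d0 E] := coords_pi x.
    exists (c / d); first by rewrite mulf_neq0 ?invr_eq0.
    by rewrite E scalerA divfK.
  exists (c * d); first by rewrite mulf_neq0.
  by move: W'c; rewrite E scalerA.
by move=> q [c c0 W'q]; exists c => //; apply: W'W.
Qed.

(** Continuity of the quotient map at the representative [coords p], carried from the subspace of
    nonzero vectors to a neighborhood in the whole vector space. *)
Lemma nbhs_line_of p (O : set (projective K m)) : nbhs p O ->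
  \forall v \near coords p, forall v0 : v != 0, O (line_of v0).
Proof.
move=> Op; have [x xp] : exists x : punctured K m,
    \pi_{eq_quot (same_line_equiv K m)} x = p /\ set_val x = coords p.
  by exists (repr (p : {eq_quot (same_line_equiv K m)})); rewrite reprK.
have := @pi_continuous _ {eq_quot (same_line_equiv K m)} x O.
rewrite xp.1 => /(_ Op); rewrite -xp.2.
case=> /= _ [[B oB <-] Bx] sBO.
have nB : nbhs (set_val x : 'rV[K]_m) B by exact: open_nbhs_nbhs.
by apply: filterS nB => v Bv v0; apply: sBO.
Qed.

End Projective.

Lemma cvg_mx (K : numFieldType) (I : Type) (F : set_system I) (m n : nat)
    (A : I -> 'M[K]_(m, n)) (B : 'M[K]_(m, n)) : Filter F ->
  (forall i j, (fun p => A p i j) @ F --> B i j) -> A @ F --> B.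
Proof.
move=> FF AB V [P /= PB PV].
have : \forall p \near F, forall i j, P i j (A p i j).
  by apply: filter_forall => i; apply: filter_forall => j; apply: AB; apply: PB.
by apply: filterS => p Pp; apply: PV => /=.
Qed.

Lemma cvg_coord (K : numFieldType) (I : Type) (F : set_system I) (m n : nat)
    (A : I -> 'M[K]_(m, n)) (B : 'M[K]_(m, n)) i j : Filter F ->
  A @ F --> B -> (fun p => A p i j) @ F --> B i j.
Proof.
move=> FF AB.
apply: (@cvg_comp _ _ _ A (fun M : 'M[K]_(m, n) => M i j) _ _ _ AB).
exact: coord_continuous.
Qed.

(** * Fibers over limits of pencils *)

Lemma sub_pencilP (F : fieldType) (m : nat) (a b v : 'rV[F]_m) :
  reflect (exists x y : F, v = x *: a + y *: b) (v <= col_mx a b)%MS.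
Proof.
apply: (iffP idP) => [/submxP[D ->]|[x [y ->]]].
  exists (lsubmx D 0 0), (rsubmx D 0 0).
  by rewrite -[D in LHS]hsubmxK mul_row_col [lsubmx D in LHS]mx11_scalar
    [rsubmx D in LHS]mx11_scalar !mul_scalar_mx.
by rewrite -addsmxE addmx_sub_adds ?scalemx_sub.
Qed.

(* A closed condition on (a, b, v) which survives passage to the limit. *)
Lemma pencil_eq (F : fieldType) (m : nat) (a b v : 'rV[F]_m) (j k c : 'I_m) :
  a 0 j = 1 -> b 0 j = 0 -> (v <= col_mx a b)%MS ->
  b 0 k * v 0 c - (v 0 j * b 0 k * a 0 c + (v 0 k - v 0 j * a 0 k) * b 0 c) = 0.
Proof. by move=> aj bj /sub_pencilP[x [y ->]]; rewrite !mxE aj bj; ring. Qed.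

(** Converse of [pencil_eq]: the coefficients on [a] and [b] are read off from the coordinates [j]
    and [k], dividing by [b 0 k]. *)
Lemma sub_pencil_eq (F : fieldType) (m : nat) (a b v : 'rV[F]_m) (j k : 'I_m) :
  b 0 k != 0 ->
  (forall c, b 0 k * v 0 c -
     (v 0 j * b 0 k * a 0 c + (v 0 k - v 0 j * a 0 k) * b 0 c) = 0) ->
  (v <= col_mx a b)%MS.
Proof.
move=> bk E; apply/sub_pencilP.
exists (v 0 j), ((v 0 k - v 0 j * a 0 k) / b 0 k); apply/rowP => c.
have /eqP := E c; rewrite subr_eq0 => /eqP Ec.
by apply: (mulfI bk); rewrite Ec !mxE; field.
Qed.

Lemma rank_pencil (F : fieldType) (m : nat) (a b : 'rV[F]_m) (j k : 'I_m) :
  a 0 j = 1 -> b 0 j = 0 -> b 0 k != 0 -> \rank (col_mx a b) = 2%N.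
Proof.
move=> aj bj bk; apply/eqP; rewrite eqn_leq rank_leq_row /=.
have b0 : b != 0 by apply: contra_neq bk => ->; rewrite mxE.
have : (b < col_mx a b)%MS.
  rewrite /ltmx -!addsmxE addsmxSr /= addsmx_sub submx_refl andbT.
  apply/negP => /sub_rVP[c] /rowP/(_ j); rewrite mxE aj bj mulr0.
  by move/eqP; rewrite oner_eq0.
by rewrite ltmxErank rank_rV b0 => /andP[].
Qed.

(** [gamma] parametrizes the points of rank two near [y0], and the row spaces there converge to a
    plane. Limits of lines stay in that plane because [pencil_eq] is a closed condition; conversely
    a line of the plane is approximated by keeping its two coefficients fixed. The row space has to
    fill the pencil only for parameters in every set of [D], which leaves room for parameters where
    the rank drops. *)
Lemma projan_fiber_pencil (K : numClosedFieldType) (T : topologicalType)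
    (m : nat) (Y : set T) (N : T -> 'M[K]_(1 + 1, m)) (y0 : T)
    (I : Type) (D : set_system I) (gamma : I -> T)
    (a b : I -> 'rV[K]_m) (a0 b0 : 'rV[K]_m) (j k : 'I_m) :
  Filter D -> Y y0 -> gamma @ D --> y0 -> a @ D --> a0 -> b @ D --> b0 ->
  (\forall p \near D, a p 0 j = 1 /\ b p 0 j = 0) -> b0 0 k != 0 ->
  (\forall p \near D, Y (gamma p) /\ (N (gamma p) <= col_mx (a p) (b p))%MS) ->
  (forall A, D A ->
     exists2 p, A p & (col_mx (a p) (b p) <= N (gamma p))%MS) ->
  (forall A, D A -> \forall y \near y0, Y y -> (1 < \rank (N y))%N ->
     exists2 p, A p & y = gamma p) ->
  forall l, projan_fiber Y N y0 l <-> (coords l <= col_mx a0 b0)%MS.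
Proof.
move=> FD Yy0 gam ca cb Hj bk Hsub Hfreq Hcov l.
have rank2 : \forall p \near D, \rank (col_mx (a p) (b p)) = 2%N.
  have bk_near : \forall p \near D, b p 0 k != 0.
    by apply: (cvgr_neq0 (b0 0 k)) bk; exact: cvg_coord.
  by apply: filterS2 Hj bk_near => p [aj bj]; exact: (rank_pencil aj bj).
(* Maximality compares [N y] with [N (gamma p)] for [p] far along [D], and some of these have rank
   two. *)
have rankN y : maximal_rank Y N y0 y -> (1 < \rank (N y))%N.
  move=> maxy.
  have A : \forall p \near D, (\rank (N (gamma p)) <= \rank (N y))%N /\
     \rank (col_mx (a p) (b p)) = 2%N.
    have near_le : \forall p \near D, Y (gamma p) ->
        (\rank (N (gamma p)) <= \rank (N y))%N := gam _ maxy.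
    apply: filterS3 near_le Hsub rank2 => p h [Yp _] r2.
    by split => //; exact: h.
  by have [p [le_y r2] /mxrankS] := Hfreq _ A; rewrite r2 => /leq_trans; apply.
have Fl : Filter (nbhs (coords l)) by exact: nbhs_filter.
pose E c (u v w : 'rV[K]_m) : K := v 0 k * w 0 c -
  (w 0 j * v 0 k * u 0 c + (w 0 k - w 0 j * u 0 k) * v 0 c).
split.
  move=> [cl _]; apply: (@sub_pencil_eq _ _ _ _ _ j k bk) => c.
  (* If one equation failed in the limit, it would fail for all nearby parameters and vectors; the
     closure supplies a nearby vector in a pencil, where it holds. *)
  apply/eqP/negPn/negP => neq0.
  have cE : (fun pw : I * 'rV[K]_m => E c (a pw.1) (b pw.1) pw.2)
      @ filter_prod D (nbhs (coords l)) --> E c a0 b0 (coords l).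
    have ca' i : (fun pw : I * 'rV[K]_m => a pw.1 0 i)
        @ filter_prod D (nbhs (coords l)) --> a0 0 i.
      by apply: cvg_coord; apply: cvg_comp ca; exact: cvg_fst.
    have cb' i : (fun pw : I * 'rV[K]_m => b pw.1 0 i)
        @ filter_prod D (nbhs (coords l)) --> b0 0 i.
      by apply: cvg_coord; apply: cvg_comp cb; exact: cvg_fst.
    have cw i : (fun pw : I * 'rV[K]_m => pw.2 0 i)
        @ filter_prod D (nbhs (coords l)) --> coords l 0 i.
      by apply: cvg_coord; exact: cvg_snd.
    rewrite /E; apply: cvgB; first by apply: cvgM.
    apply: cvgD; first by apply: cvgM => //; apply: cvgM.
    by apply: cvgM => //; apply: cvgB => //; apply: cvgM.
  have [[A W] /= [DA Wl] AW] : \forall pw \near filter_prod D (nbhs (coords l)),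
      E c (a pw.1) (b pw.1) pw.2 != 0.
    by apply: (cvgr_neq0 _) neq0.
  (* Near [y0], every point of maximal rank comes from a parameter in [A] at which the normalization
     and the inclusion in the pencil hold. *)
  pose V := [set y | Y y -> (1 < \rank (N y))%N -> exists2 p, (A p /\
    (a p 0 j = 1 /\ b p 0 j = 0) /\ (N (gamma p) <= col_mx (a p) (b p))%MS)
    & y = gamma p].
  have nV : nbhs y0 V.
    apply: Hcov; apply: filterS3 DA Hj Hsub => p ? ? [_ ?].
    by split.
  have nW := nbhs_projective_cone Wl.
  have [[y q] [/= [Yy maxy qy] [/= Vy [d d0 Wq]]]] :=
    cl _ (ex_intro2 _ _ (V, _) (conj nV nW) (fun _ h => h)).
  have [p [Ap [[aj bj] Np]] yE] := Vy Yy (rankN _ maxy).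
  have := AW (p, d *: coords q) (conj Ap Wq); rewrite /= /E.
  rewrite (pencil_eq k c aj bj) ?eqxx // scalemx_sub //.
  by rewrite (submx_trans qy) // yE.
move=> /sub_pencilP[x [z wE]]; split => //= O -[[V W] /= [nV nW] VW].
(* Conversely, the coefficients of [coords l] on the limit pencil are reused on the nearby
   pencils. *)
have cv : (fun p => x *: a p + z *: b p) @ D --> coords l.
  rewrite wE; apply: cvgD; apply: cvgZr => //.
have v_neq0 : \forall p \near D, x *: a p + z *: b p != 0.
  by apply: (cvgr_neq0 (coords l)) => //; exact: coords_neq0.
have W_near : \forall p \near D, forall v0 : x *: a p + z *: b p != 0,
    W (line_of v0) := cv _ (nbhs_line_of nW).
have V_near : \forall p \near D, V (gamma p) := gam _ nV.
have A : \forall p \near D, (exists v0 : x *: a p + z *: b p != 0,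
    W (line_of v0)) /\ [/\ V (gamma p), Y (gamma p) &
      \rank (col_mx (a p) (b p)) = 2%N].
  apply: filterS2 (filterI v_neq0 W_near) (filterI V_near (filterI rank2 Hsub)).
  by move=> p [v0 Wv] [Vp [r2 [Yp _]]]; split => //; exists v0; exact: Wv.
have [p [[v0 Wv] [Vp Yp r2]] /[dup] Np /mxrankS] := Hfreq _ A.
rewrite r2 => rN; exists (gamma p, line_of v0); split; last exact: VW.
split => //=.
  by apply: nearW => y _; exact: leq_trans (rank_leq_row _) rN.
have /andP[h _] := coords_line_of v0; apply: submx_trans h _.
by apply: submx_trans Np; apply/sub_pencilP; exists x, z.
Qed.

(** * Difference quotients *)

(** Both parameters tend to 0 independently. The excluded diagonal gives points where the two rows
    coincide, hence rank at most one. *)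
Definition off_diagonal (K : numClosedFieldType) : set_system (K * K) :=
  within [set st | st.1 != st.2] (nbhs (0 : K, 0 : K)).

Arguments off_diagonal : clear implicits.

Lemma nbhs0_ball (K : numFieldType) (P : set K) :
  (\forall z \near (0 : K), P z) ->
  exists2 d, 0 < d & forall z, `|z| < d -> P z.
Proof.
by move=> [d /= d0 Hd]; exists d => // z zd; apply: Hd; rewrite /= sub0r normrN.
Qed.

Lemma off_diagonal_ball (K : numClosedFieldType) (d : K) : 0 < d ->
  off_diagonal K [set st | (`|st.1| < d /\ `|st.2| < d) /\ st.1 != st.2].
Proof.
move=> d0; exists ([set s : K | `|s| < d], [set s : K | `|s| < d]) => /=.
  by split; exists d => // z; rewrite /= sub0r normrN.
by move=> [s t] /= [sd td] st; do !split.
Qed.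

Lemma off_diagonalP (K : numClosedFieldType) (A : set (K * K)) :
  off_diagonal K A -> exists2 d : K, 0 < d &
    forall s t, `|s| < d -> `|t| < d -> s != t -> A (s, t).
Proof.
move=> [[U V] /= [/nbhs0_ball[d d0 dU] /nbhs0_ball[e e0 eV]] UV].
have [r r0 [rd re]] : exists2 r : K, 0 < r & r <= d /\ r <= e.
  have de : d >=< e := real_comparable (gtr0_real d0) (gtr0_real e0).
  by case/orP: de => ?; [exists d | exists e].
exists r => // s t sr tr; apply: (UV (s, t)); split => /=.
  by apply: dU; apply: lt_le_trans rd.
by apply: eV; apply: lt_le_trans re.
Qed.

(** Subtracting [w * c] prepares the mean value inequality: it will bound the deviation of a
    difference quotient from [c]. *)
Lemma derive_sub_linear (K : numFieldType) (m : nat) (h : K -> 'rV[K]_m)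
    (j : 'I_m) (c v z : K) : differentiable h z ->
  differentiable (fun w => h w 0 j - w * c) z /\
  'D_v (fun w => h w 0 j - w * c) z = v * ('d h z 1 0 j - c).
Proof.
move=> dh; have dv : derivable h z v by exact: diff_derivable.
have dhj : differentiable (fun w => h w 0 j) z.
  exact: (@differentiable_comp _ _ _ _ _ (fun N : 'rV[K]_m => N 0 j) _ dh
    (@differentiable_coord _ _ _ _ _ _)).
have dc : is_derive z v (fun w : K => w * c) (v * c).
  apply: is_derive_eq. rewrite scaler0 add0r [_ *: _]mulrC //.
have dcd : differentiable (fun w : K => w * c) z by exact: differentiableM.
split; first exact: differentiableB.
have dhjv : derivable (fun w => h w 0 j) z v by exact: diff_derivable.
have -> : 'D_v (fun w => h w 0 j - w * c) z =
    'D_v (fun w => h w 0 j) z - 'D_v (fun w : K => w * c) z.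
  by apply: deriveB.
rewrite derive_val mulrBr; congr (_ - _).
have -> : 'D_v (fun w => h w 0 j) z = ('D_v h z) 0 j.
  have cj : (fun k : K => (k^-1 *: ((h \o shift z) (k *: v) - h z)) 0 j) @ 0^'
      --> ('D_v h z) 0 j by apply: cvg_coord; exact: dv.
  rewrite /derive.
  have -> : (fun k : K =>
      k^-1 *: (((fun w => h w 0 j) \o shift z) (k *: v) - h z 0 j)) =
    (fun k : K => (k^-1 *: ((h \o shift z) (k *: v) - h z)) 0 j).
    by apply/funext => k; rewrite !mxE.
  exact: (cvg_lim (@norm_hausdorff _ _) cj).
by rewrite deriveE // -[v in LHS]mulr1 -[v * 1]/(v *: 1) linearZ /= mxE.
Qed.

(** This is strict differentiability at 0, with both points moving. By continuity of the
    differential, [h w 0 j - w * c] has derivative of norm at most [e] near 0, so its increment from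
    [t] to [s] is at most [|s - t| e]. *)
Lemma difference_quotient_cvg (R : realType) (m : nat)
    (h : Cfield R -> 'rV[Cfield R]_m) : holomorphic_at h 0 ->
  (fun st : Cfield R * Cfield R => (st.1 - st.2)^-1 *: (h st.1 - h st.2))
    @ off_diagonal (Cfield R) --> h^`()%classic 0.
Proof.
move=> hol; apply: cvg_mx => i j; rewrite ord1.
have dh0 : differentiable h 0 by have [] := nbhs_singleton hol.
rewrite derive1E'//; set c := 'd h 0 1 0 j.
apply/cvgrPdist_le => e e0.
have near_d : \forall z \near (0 : Cfield R), `|c - 'd h z 1 0 j| <= e.
  have cont : {for 0, continuous (fun z => 'd h z 1 : 'rV[Cfield R]_m)}.
    by have [] := nbhs_singleton hol.
  have cj : (fun z => 'd h z 1 0 j) @ nbhs (0 : Cfield R) --> c by exact: cvg_coord.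
  by move/cvgrPdist_le : cj; apply.
have [d /= d0 Hd] : exists2 d : Cfield R, 0 < d & forall z, `|z| < d ->
   differentiable h z /\ `|c - 'd h z 1 0 j| <= e.
  by apply: nbhs0_ball; apply: filterS2 hol near_d => z [].
apply: (filterS (P := [set st | (`|st.1| < d /\ `|st.2| < d) /\ st.1 != st.2])).
  move=> [s t] /= [[sd td] st].
  have le_e : `|(h s 0 j - s * c) - (h t 0 j - t * c)| <= `|s - t| * e.
    apply: (@mean_value_complex R (fun w => h w 0 j - w * c)) => x /andP[x0 x1].
    set z : Cfield R := t + x%:C * (s - t).
    have [dz le_e] : differentiable h z /\ `|c - 'd h z 1 0 j| <= e.
      (* Balls are convex: the point of the segment is a convex combination of [t] and [s]. *)
      apply: Hd; have -> : z = (1 - x)%:C * t + x%:C * s.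
        by rewrite /z rmorphB rmorph1; ring.
      apply: le_lt_trans (ler_normD _ _) _; rewrite !normrM.
      have nr (y : R) : 0 <= y -> `|y%:C : Cfield R| = y%:C.
        by move=> y0; rewrite ger0_norm // lecR.
      rewrite !nr ?subr_ge0 //.
      (* The strict inequality below comes from the term in [s], whose coefficient must be
         positive. *)
      have [-> | xn0] := eqVneq x 0.
        by rewrite subr0 rmorph0 rmorph1 mul0r mul1r addr0.
      have -> : d = (1 - x)%:C * d + x%:C * d.
        by rewrite -mulrDl -rmorphD subrK rmorph1 mul1r.
      rewrite ler_ltD //.
        by apply: ler_wpM2l; [rewrite lecR subr_ge0 | exact: ltW].
      have x_gt0 : 0 < (x%:C : Cfield R).
        by rewrite (ltcR 0 x) lt_neqAle eq_sym xn0.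
      by rewrite ltr_pM2l.
    have [dphi Dphi] := derive_sub_linear j c (s - t) dz.
    split; [exact: dphi|rewrite Dphi].
    rewrite normrM; apply: ler_wpM2l; first exact: normr_ge0.
    by rewrite -normrN opprB; exact: le_e.
  have st0 : s - t != 0 by rewrite subr_eq0.
  rewrite !mxE -(ler_pM2l (x := `|s - t|)) ?normr_gt0 // -normrM.
  rewrite mulrBr mulVKf // distrC; apply: le_trans le_e.
  by rewrite /c le_eqVlt; apply/orP; left; apply/eqP; congr (`|_|); ring.
exact: off_diagonal_ball.
Qed.

(** * Curves of multiplicity two *)

Lemma cvg_mulmx (K : numFieldType) (I : Type) (F : set_system I) (m n p : nat)
    (A : I -> 'M[K]_(m, n)) (B : I -> 'M[K]_(n, p))
    (A0 : 'M[K]_(m, n)) (B0 : 'M[K]_(n, p)) : Filter F ->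
  A @ F --> A0 -> B @ F --> B0 -> (fun x => A x *m B x) @ F --> A0 *m B0.
Proof.
move=> FF cA cB; apply: cvg_mx => i j.
under eq_cvg do rewrite mxE.
rewrite mxE.
apply: cvg_big => [|k _]; first exact: add_continuous.
by apply: cvgM; apply: cvg_coord.
Qed.

Lemma open_dot_neq0 (K : numClosedFieldType) (n : nat) (v : 'rV[K]_n) :
  open [set l : 'cV[K]_n | (v *m l) 0 0 != 0].
Proof.
rewrite openE => l /= vl.
have cl : (fun x : 'cV[K]_n => (v *m x) 0 0) @ nbhs l --> (v *m l) 0 0.
  by apply: cvg_coord; apply: cvg_mulmx; [exact: cvg_cst | exact: cvg_id].
have := @cvgr_neq0 _ _ _ _ _ _ _ cl vl; exact.
Qed.

Lemma not_card2 (T : Type) (S : set T) (z0 : T) :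
  (forall x y, S x -> S y -> x = y) -> ~ (S #= `I_2)%card.
Proof.
move=> S1 /card_eqPle[_ S2].
have [z Sz] : exists z, S `<=` [set z].
  have [[z Sz]|S0] := pselect (S !=set0); first by exists z => x Sx; exact: S1.
  by exists z0 => x Sx; case: S0; exists x.
have /card_eqPle[z1 _] := @card_set1 _ z.
have := card_le_trans S2 (card_le_trans (subset_card_le Sz) z1).
by rewrite card_le_II.
Qed.

(** If [v = eta'(0)] were nonzero, a generic linear form [l] would have [v l != 0]. The difference
    quotients of [eta t *m l] then stay away from 0, so this function is injective near 0, and a
    hyperplane on which [l] is constant meets [C] at most once there. *)
Lemma multiplicity2_derive0 (R : realType) (n : nat) (C : set 'rV[Cfield R]_n)
    (eta : Cfield R -> 'rV[Cfield R]_n) :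
  curve_multiplicity C 2 -> normalization C eta -> eta^`()%classic 0 = 0.
Proof.
move=> [L [_ dL HL]] [[hol eta0] _ _ Ceta _].
apply: contrapT => /eqP v0; set v := eta^`()%classic 0 in v0.
have [k vk] : exists k, v 0 k != 0 by apply/rV0Pn.
have [l [/= vl Ll]] : [set l | (v *m l) 0 0 != 0] `&` L !=set0.
  apply: dL; last exact: open_dot_neq0.
  exists (delta_mx k 0) => /=; rewrite -colE mxE //.
have ql : (fun st : Cfield R * Cfield R =>
    (((st.1 - st.2)^-1 *: (eta st.1 - eta st.2)) *m l) 0 0)
    @ off_diagonal (Cfield R) --> (v *m l) 0 0.
  apply: cvg_coord; apply: cvg_mulmx; last exact: cvg_cst.
  exact: difference_quotient_cvg.
have [d d0 Hd] := off_diagonalP (@cvgr_neq0 _ _ _ _ _ _ _ ql vl).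
have inj s t : `|s| < d -> `|t| < d ->
    (eta s *m l) 0 0 = (eta t *m l) 0 0 -> s = t.
  move=> sd td E; apply/eqP/negPn/negP => /(Hd _ _ sd td)/=.
  have E0 : ((eta s - eta t) *m l) 0 0 = 0.
    by rewrite mulmxBl [LHS]mxE [X in _ + X]mxE E subrr.
  by rewrite -scalemxAl mxE E0 mulr0 eqxx.
have nd : nbhs (0 : Cfield R) [set s | `|s| < d].
  by exists d => // z; rewrite /= sub0r normrN.
(* The neighborhood [V] consists of the points that, if on [C], have a parameter in the ball of
   injectivity. *)
have [U [_ UV /filter_ex[e]]] := HL l Ll _ (Ceta _ nd).
apply: (not_card2 0) => x y /= [[Cx Ux] xe] [[Cy Uy] ye].
have [s sd sx] := UV _ Ux Cx; have [t td ty] := UV _ Uy Cy.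
rewrite -sx -ty; congr eta; apply: inj => //; rewrite sx ty.
exact: etrans xe (esym ye).
Qed.

(** * Fibers over pairs of points of a parametrized curve *)

Lemma cvg_row_mx (K : numFieldType) (I : Type) (F : set_system I) (m n : nat)
    (A : I -> 'rV[K]_m) (B : I -> 'rV[K]_n) (A0 : 'rV[K]_m) (B0 : 'rV[K]_n) :
  Filter F -> A @ F --> A0 -> B @ F --> B0 ->
  (fun x => row_mx (A x) (B x)) @ F --> row_mx A0 B0.
Proof.
move=> FF cA cB; apply: cvg_mx => i j.
case: (split_ordP j) => k ->.
  rewrite row_mxEl; under eq_cvg do rewrite row_mxEl; exact: cvg_coord.
rewrite row_mxEr; under eq_cvg do rewrite row_mxEr; exact: cvg_coord.
Qed.

Lemma cvg_mxvec (K : numFieldType) (I : Type) (F : set_system I) (m n : nat)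
    (A : I -> 'M[K]_(m, n)) (A0 : 'M[K]_(m, n)) :
  Filter F -> A @ F --> A0 -> (fun x => mxvec (A x)) @ F --> mxvec A0.
Proof.
move=> FF cA; apply: cvg_mx => i j; rewrite ord1.
case/mxvec_indexP: j => k l.
rewrite mxvecE; under eq_cvg do rewrite mxvecE; exact: cvg_coord.
Qed.

Lemma cvg_trmx (K : numFieldType) (I : Type) (F : set_system I) (m n : nat)
    (A : I -> 'M[K]_(m, n)) (A0 : 'M[K]_(m, n)) :
  Filter F -> A @ F --> A0 -> (fun x => (A x)^T) @ F --> A0^T.
Proof.
move=> FF cA; apply: cvg_mx => i j.
rewrite mxE; under eq_cvg do rewrite mxE; exact: cvg_coord.
Qed.

#[local] Instance off_diagonal_filter (K : numClosedFieldType) :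
  Filter (off_diagonal K).
Proof. exact: within_filter. Qed.

Lemma off_diagonal_fst (K : numClosedFieldType) :
  (fun st : K * K => st.1) @ off_diagonal K --> (0 : K).
Proof.
apply: (cvg_trans (G := (fun st : K * K => st.1) @ nbhs (0 : K, 0 : K))).
  by apply: cvg_app; exact: cvg_within.
exact: cvg_fst.
Qed.

Lemma off_diagonal_snd (K : numClosedFieldType) :
  (fun st : K * K => st.2) @ off_diagonal K --> (0 : K).
Proof.
apply: (cvg_trans (G := (fun st : K * K => st.2) @ nbhs (0 : K, 0 : K))).
  by apply: cvg_app; exact: cvg_within.
exact: cvg_snd.
Qed.

(** Choosing [t] after [s] with [|t| < |s|] makes the two parameters distinct. *)
Lemma off_diagonal_neq0 (K : numClosedFieldType) (A : set (K * K)) (P : set K) :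
  off_diagonal K A -> (\forall t \near (0 : K)^', P t) ->
  exists st, [/\ A st, st.1 != st.2, P st.1 & P st.2].
Proof.
move=> /off_diagonalP[d d0 dA] P0.
have ball_near (r : K) : 0 < r -> \forall t \near (0 : K)^', `|t| < r.
  by move=> r0; apply: nbhs_dnbhs; exists r => // z; rewrite /= sub0r normrN.
have [s [[sd Ps] s0]] :=
  filter_ex (filterI (filterI (ball_near d d0) P0) (nbhs_dnbhs_neq (0 : K))).
have s_gt0 : 0 < `|s| by rewrite normr_gt0.
have [t [[td Pt] ts]] :=
  filter_ex (filterI (filterI (ball_near d d0) P0) (ball_near _ s_gt0)).
have st : s != t by apply: contraTneq ts => ->; rewrite ltxx.
by exists (s, t); split => //; exact: dA.
Qed.

(** Common form of both modules: up to the factor [c], the rows at two points of the curve are [a]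
    and [a - (s - t) b], so they span the same plane as [a] and the difference quotient [b] when
    [c s], [c t] and [s - t] are nonzero. *)
Lemma projan_fiber_curve (K : numClosedFieldType) (n m : nat)
    (C : set 'rV[K]_n) (eta : K -> 'rV[K]_n)
    (r1 r2 : 'rV[K]_n * 'rV[K]_n -> 'rV[K]_m) (c : K -> K)
    (a b : K * K -> 'rV[K]_m) (a0 b0 : 'rV[K]_m) (j k : 'I_m) :
  C 0 -> normalization C eta ->
  (forall x, r1 (x, x) = r2 (x, x)) ->
  (\forall t \near 0^', c t != 0) ->
  (\forall st \near off_diagonal K,
     [/\ r1 (eta st.1, eta st.2) = c st.1 *: a st,
         r2 (eta st.1, eta st.2) = c st.2 *: (a st - (st.1 - st.2) *: b st),
         a st 0 j = 1 & b st 0 j = 0]) ->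
  a @ off_diagonal K --> a0 -> b @ off_diagonal K --> b0 -> b0 0 k != 0 ->
  forall l, projan_fiber_CxC C (fun xy => col_mx (r1 xy) (r2 xy)) l <->
    (coords l <= col_mx a0 b0)%MS.
Proof.
move=> C0 [[hol eta0] Ceta _ surj _] r12 c0 Hr ca cb bk l.
have ceta : eta @ nbhs (0 : K) --> (0 : 'rV[K]_n).
  have : eta @ nbhs (0 : K) --> eta 0.
    by apply: differentiable_continuous; have [] := nbhs_singleton hol.
  by rewrite eta0.
have cgamma : (fun st => (eta st.1, eta st.2)) @ off_diagonal K -->
    nbhs ((0, 0) : 'rV[K]_n * 'rV[K]_n).
  exact: (@cvg_pair _ _ _ (off_diagonal K)
    (nbhs (0 : 'rV[K]_n)) (nbhs (0 : 'rV[K]_n)) _ _ _ (fun st => eta st.1) (fun st => eta st.2)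
    (cvg_comp _ _ (@off_diagonal_fst K) ceta)
    (cvg_comp _ _ (@off_diagonal_snd K) ceta)).
apply: (@projan_fiber_pencil _ _ _ _ _ _ _ (off_diagonal K)
  (fun st => (eta st.1, eta st.2)) a b a0 b0 j k) => //.
- by apply: filterS Hr => st [].
- have C1 : \forall st \near off_diagonal K, C (eta st.1) := off_diagonal_fst Ceta.
  have C2 : \forall st \near off_diagonal K, C (eta st.2) := off_diagonal_snd Ceta.
  apply: filterS3 C1 C2 Hr => st ? ? [E1 E2 _ _]; split => //.
  rewrite col_mx_sub E1 E2 !scalemx_sub //.
    rewrite -scaleNr; apply/sub_pencilP; exists 1, (- (st.1 - st.2)).
    by rewrite scale1r.
  by apply/sub_pencilP; exists 1, 0; rewrite scale1r scale0r addr0.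
- move=> A nA; have [st [[Ast [E1 E2 _ _]] st12 cs ct]] :=
    off_diagonal_neq0 (filterI nA Hr) c0.
  exists st => //; rewrite E1 E2.
  have st0 : st.1 - st.2 != 0 by rewrite subr_eq0.
  rewrite col_mx_sub; apply/andP; split; apply/sub_pencilP.
    by exists (c st.1)^-1, 0; rewrite scale0r addr0 scalerK.
  (* Solving for [b] gives [(r1 / c s - r2 / c t) / (s - t)]. *)
  exists ((st.1 - st.2)^-1 / c st.1), (- ((st.1 - st.2)^-1 / c st.2)).
  rewrite !scalerA -mulrA mulVf // mulr1 mulNr -mulrA mulVf // mulr1.
  by rewrite scaleNr scalerBr opprB addrC scalerA mulVf // scale1r subrK.
- move=> A nA; have [d d0 dA] := off_diagonalP nA.
  have nd : nbhs (0 : K) [set s | `|s| < d].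
    by exists d => // z; rewrite /= sub0r normrN.
  (* Points of [C] near 0 have small parameters, by the homeomorphism property of the
     normalization. *)
  exists ([set z | C z -> (eta @` [set s | `|s| < d]) z],
          [set z | C z -> (eta @` [set s | `|s| < d]) z]) => /=.
    by split; exact: surj.
  move=> [x y] /= [hx hy] [Cx Cy] rk.
  have [s sd sx] := hx Cx; have [t td ty] := hy Cy.
  exists (s, t); last by rewrite /= sx ty.
  apply: dA => //; apply: contraTneq rk => st.
  rewrite -leqNgt -sx -ty st r12.
  rewrite (leq_trans _ (rank_leq_row (r2 (eta t, eta t)))) //.
  by apply: mxrankS; rewrite col_mx_sub submx_refl.
Qed.

(** * The Gauss map along the curve *)

(** The chart makes the [j]-th coordinate of [u] equal to 1, so the proportionality factor between
    [Df f (eta t)] and [u t] is the [j]-th partial derivative. *)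
Lemma gauss_chart (K : numClosedFieldType) (n : nat) (f : 'rV[K]_n -> K)
    (eta : K -> 'rV[K]_n) :
  holomorphic_at f 0 -> holomorphic_at eta 0 -> eta 0 = 0 ->
  gauss_extends_to_embedding f eta ->
  exists (u : K -> 'rV[K]_n) (j : 'I_n),
    [/\ holomorphic_at u 0, u^`()%classic 0 != 0,
        \forall t \near 0, u t 0 j = 1,
        \forall t \near 0, Df f (eta t) = Df f (eta t) 0 j *: u t
      & \forall t \near 0^', Df f (eta t) 0 j != 0].
Proof.
move=> hf heta eta0 [g [gauss_g [j [gj hu u'0]]]].
pose u t := affine_chart j (g t); exists u, j.
have uj : \forall t \near 0, u t 0 j = 1.
  by apply: filterS gj => t gtj; rewrite /u /affine_chart mxE mulVf.
have Dfu : \forall t \near 0^',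
    Df f (eta t) = Df f (eta t) 0 j *: u t /\ Df f (eta t) 0 j != 0.
  apply: filterS2 gauss_g (nbhs_dnbhs gj) => t [xs gE] gtj.
  have [c c0 DfE] := eqmx_row_scale (coords_neq0 _) (coords_line_of (proj2 xs)).
  rewrite -/(gauss_map xs) -gE in DfE.
  rewrite DfE mxE /u /affine_chart scalerA mulfK //; split => //.
  exact: mulf_neq0.
split => //; last by apply: filterS Dfu => t [].
have ceta : eta @ nbhs (0 : K) --> (0 : 'rV[K]_n).
  have : eta @ nbhs (0 : K) --> eta 0.
    by apply: differentiable_continuous; have [] := nbhs_singleton heta.
  by rewrite eta0.
have cu : u @ nbhs (0 : K) --> u 0.
  by apply: differentiable_continuous; have [] := nbhs_singleton hu.
have cDf i : (fun t => Df f (eta t) 0 i) @ nbhs (0 : K) --> Df f (eta 0) 0 i.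
  have cD : (fun z => Df f z 0 i) @ nbhs (0 : 'rV[K]_n) --> Df f 0 0 i.
    have [df0 /(_ (delta_mx 0 i)) cd] := nbhs_singleton hf.
    rewrite /Df mxE deriveE //; apply: cvg_trans cd; apply: near_eq_cvg.
    by apply: filterS hf => z [dz _]; rewrite mxE deriveE.
  rewrite eta0; exact: (cvg_comp _ _ ceta cD).
(* The Gauss map gives the relation only for [t != 0]; at 0 both sides are limits of the same
   function. *)
have E0 : Df f (eta 0) = Df f (eta 0) 0 j *: u 0.
  apply/rowP => i; rewrite [RHS]mxE.
  have c1 : (fun t => Df f (eta t) 0 i) @ (0 : K)^' --> Df f (eta 0) 0 i.
    by apply: cvg_trans (cDf i); apply: cvg_app; exact: cvg_within.
  have c2 : (fun t => Df f (eta t) 0 i) @ (0 : K)^' -->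
      Df f (eta 0) 0 j * u 0 0 i.
    have : (fun t => Df f (eta t) 0 j * u t 0 i) @ (0 : K)^' -->
      Df f (eta 0) 0 j * u 0 0 i.
      have : (fun t => Df f (eta t) 0 j * u t 0 i) @ nbhs (0 : K) -->
        Df f (eta 0) 0 j * u 0 0 i.
        by apply: cvgM => //; exact: cvg_coord.
      by apply: cvg_trans; apply: cvg_app; exact: cvg_within.
    apply: cvg_trans; apply: near_eq_cvg; apply: filterS Dfu => t [E _].
    by have /rowP/(_ i) := E; rewrite [RHS]mxE => Ei; rewrite -Ei.
  exact: (cvg_unique (@norm_hausdorff _ K) c1 c2).
have : \forall t \near (0 : K)^', Df f (eta t) = Df f (eta t) 0 j *: u t.
  by apply: filterS Dfu => t [].
rewrite /dnbhs near_withinE => H; apply: filterS H => t.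
by have [-> _|t0] := eqVneq t 0; [exact: E0 | apply].
Qed.

(** * Comparison of the two fibers *)

(** The last columns form an outer product, so limits pass through matrix multiplication, and this
    block vanishes on the diagonal. *)
Lemma JDE (K : numClosedFieldType) (n : nat) (f : 'rV[K]_n -> K) :
  JD f = fun xy => col_mx (row_mx (Df f xy.1) 0)
    (row_mx (Df f xy.2) (mxvec ((xy.1 - xy.2)^T *m Df f xy.2))).
Proof.
apply/funext => xy; rewrite /JD /JDminus -block_mxEh block_mxEv.
congr (col_mx _ (row_mx _ (mxvec _))); apply/matrixP => i j.
by rewrite !mxE big_ord1 !mxE.
Qed.

Lemma projan_fiber_JD (K : numClosedFieldType) (n : nat) (f : 'rV[K]_n -> K)
    (C : set 'rV[K]_n) (eta u : K -> 'rV[K]_n) (w : 'rV[K]_n) (j : 'I_n) :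
  C 0 -> normalization C eta ->
  (fun st : K * K => (st.1 - st.2)^-1 *: (eta st.1 - eta st.2))
    @ off_diagonal K --> (0 : 'rV[K]_n) ->
  u @ nbhs (0 : K) --> u 0 ->
  (fun st : K * K => (st.1 - st.2)^-1 *: (u st.1 - u st.2))
    @ off_diagonal K --> w -> w != 0 ->
  (\forall t \near 0, u t 0 j = 1) ->
  (\forall t \near 0, Df f (eta t) = Df f (eta t) 0 j *: u t) ->
  (\forall t \near 0^', Df f (eta t) 0 j != 0) ->
  projan_fiber_CxC C (JD f) =
  proj_incl (n * n) @` projan_fiber_CxC C (JDminus f).
Proof.
move=> C0 norm cq cu cb w0 uj DfE Dfj.
have [k wk] : exists k, w 0 k != 0 by apply/rV0Pn.
pose a (st : K * K) := u st.1.
pose b (st : K * K) := (st.1 - st.2)^-1 *: (u st.1 - u st.2).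
pose q (st : K * K) := (st.1 - st.2)^-1 *: (eta st.1 - eta st.2).
(* The sign makes [- (s - t) b'] equal to the outer product of [eta s - eta t] and [u t]. As the
   quotients [q] tend to 0, so does [b']. *)
pose b' (st : K * K) := - mxvec ((q st)^T *m u st.2).
have ca : a @ off_diagonal K --> u 0 := cvg_comp _ _ (@off_diagonal_fst K) cu.
have cb' : b' @ off_diagonal K --> (0 : 'rV[K]_(n * n)).
  have -> : 0 = - mxvec (0^T *m u 0) :> 'rV[K]_(n * n).
    by rewrite trmx0 mul0mx linear0 oppr0.
  apply: cvgN; apply: cvg_mxvec; apply: cvg_mulmx.
    exact: cvg_trmx.
  exact: (cvg_comp _ _ (@off_diagonal_snd K) cu).
have neq_st : \forall st \near off_diagonal K, st.1 - st.2 != 0.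
  by rewrite near_withinE; apply: nearW => st; rewrite subr_eq0.
have near1 : \forall st \near off_diagonal K,
    u st.1 0 j = 1 /\ Df f (eta st.1) = Df f (eta st.1) 0 j *: u st.1.
  exact: (off_diagonal_fst (filterI uj DfE)).
have near2 : \forall st \near off_diagonal K,
    u st.2 0 j = 1 /\ Df f (eta st.2) = Df f (eta st.2) 0 j *: u st.2.
  exact: (off_diagonal_snd (filterI uj DfE)).
have uE st : st.1 - st.2 != 0 -> a st - (st.1 - st.2) *: b st = u st.2.
  by move=> st0; rewrite /b scalerA mulfV // scale1r opprB addrC subrK.
have fiber1 l : projan_fiber_CxC C (JDminus f) l <->
    (coords l <= col_mx (u 0) w)%MS.
  apply: (@projan_fiber_curve K n n C eta
    (fun xy => Df f xy.1) (fun xy => Df f xy.2)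
    (fun t => Df f (eta t) 0 j) a b (u 0) w j k) => //.
  apply: filterS3 neq_st near1 near2 => st st0 [u1 E1] [u2 E2].
  by split; rewrite ?uE // /b !mxE u1 u2 subrr mulr0.
have fiber2 l : projan_fiber_CxC C (JD f) l <->
    (coords l <= col_mx (row_mx (u 0) (0 : 'rV_(n * n))) (row_mx w 0))%MS.
  rewrite JDE; apply: (@projan_fiber_curve K n (n + n * n) C eta
    (fun xy => row_mx (Df f xy.1) 0)
    (fun xy => row_mx (Df f xy.2) (mxvec ((xy.1 - xy.2)^T *m Df f xy.2)))
    (fun t => Df f (eta t) 0 j)
    (fun st => row_mx (a st) 0) (fun st => row_mx (b st) (b' st))
    (row_mx (u 0) 0) (row_mx w 0) (lshift _ j) (lshift _ k)) => //.
  - by move=> x /=; rewrite subrr trmx0 mul0mx linear0.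
  - apply: filterS3 neq_st near1 near2 => st st0 [u1 E1] [u2 E2].
    split; rewrite ?row_mxEl //; last by rewrite /b !mxE u1 u2 subrr mulr0.
      by rewrite scale_row_mx scaler0 -E1.
    rewrite !scale_row_mx opp_row_mx add_row_mx uE // scale_row_mx -E2 add0r.
    congr row_mx; rewrite /b' !scalerN opprK.
    have -> : (q st)^T = (st.1 - st.2)^-1 *: (eta st.1 - eta st.2)^T.
      by apply/matrixP => ? ?; rewrite !mxE.
    rewrite -scalemxAl [mxvec (_ *: (_ *m u _))]linearZ /= [X in _ *: X]scalerA.
    by rewrite mulfV // scale1r [in LHS]E2 -scalemxAr linearZ.
  - by apply: cvg_row_mx => //; exact: cvg_cst.
  - exact: cvg_row_mx.
  - by rewrite row_mxEl.
(* Both fibers are now explicit planes, the second being the first padded by zeros; what remains is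
   that representatives agree up to a nonzero scalar. *)
apply/seteqP; split => [l /fiber2/sub_pencilP[x [y lE]]|_ [p /fiber1 pE <-]].
  rewrite !scale_row_mx !scaler0 add_row_mx addr0 in lE.
  have v0 : x *: u 0 + y *: w != 0.
    by apply: contra_neq (coords_neq0 l) => v0; rewrite lE v0 row_mx0.
  have /andP[pv vp] := coords_line_of v0.
  exists (line_of v0).
    by apply/fiber1; apply: submx_trans pv _; apply/sub_pencilP; exists x, y.
  apply: projective_eqP.
  have [c c0 vE] := eqmx_row_scale (coords_neq0 _) (coords_line_of v0).
  have /andP[h1 h2] :=
    coords_line_of (row_mx0_neq0 (n * n) (coords_neq0 (line_of v0))).
  have E : coords l = c *: row_mx (coords (line_of v0)) 0.
    by rewrite lE scale_row_mx scaler0 -vE.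
  apply/andP; split; last by rewrite E scalemx_sub.
  apply: submx_trans h1 _; rewrite E.
  by apply/sub_rVP; exists c^-1; rewrite scalerK.
apply/fiber2.
have /andP[h1 _] := coords_line_of (row_mx0_neq0 (n * n) (coords_neq0 p)).
apply: submx_trans h1 _; have /sub_pencilP[x [y ->]] := pE.
by apply/sub_pencilP; exists x, y;
  rewrite !scale_row_mx !scaler0 add_row_mx addr0.
Qed.

Theorem theorem3p6 (R : realType) (n : nat) (f : 'rV[R[i]]_n -> R[i])
    (C : set 'rV[R[i]]_n) (eta : R[i] -> 'rV[R[i]]_n) :
  hypersurface f ->
  irreducible_curve C ->
  subgerm C (zeros f) ->
  subgerm (C `\ 0) (smooth_locus f) ->
  curve_multiplicity C 2 ->
  ~ line_germ C ->
  normalization C eta ->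
  gauss_extends_to_embedding f eta ->
  projan_fiber_CxC C (JD f) =
  proj_incl (n * n) @` projan_fiber_CxC C (JDminus f).
Proof.
move=> [hf _ _] [[C0 _ _] _] _ _ mult2 _ norm gauss_ext.
have [[heta eta0] _ _ _ _] := norm.
have [u [j [hu u'0 uj DfE Dfj]]] := gauss_chart hf heta eta0 gauss_ext.
have cq := difference_quotient_cvg heta.
(* Multiplicity two makes the limit of the difference quotients of [eta] equal to 0. *)
rewrite (multiplicity2_derive0 mult2 norm) in cq.
apply: (projan_fiber_JD C0 norm cq _ (difference_quotient_cvg hu) u'0 uj DfE Dfj).
by apply: differentiable_continuous; have [] := nbhs_singleton hu.
Qed.
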